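(* Let $\phi_1,\phi_2\in D=\{z\in\mathbb{C};|z|<1\}$. Let $Z_1$ and $Z_2$ be the points of first exit from the unit disc $D$ of two independent $\mathbb{C}$-valued Brownian motions without drift started at $\phi_1$ and $\phi_2$, respectively. Then the conditional distribution of $Z=Z_1$ given $Z_1=Z_2$ has density, with respect to arc length on $\partial D=\{|z|=1\}$, $$f(z)=\frac{1}{2\pi}\frac{|1-\phi_1\overline{\phi_2}|^2}{1-|\phi_1\overline{\phi_2}|^2}\frac{1-|\phi_1|^2}{|z-\phi_1|^2}\frac{1-|\phi_2|^2}{|z-\phi_2|^2},\qquad z\in\partial D.$$
   Context: The first exit point from $D$ of planar Brownian motion started at $\phi\in D$ has density $(2\pi)^{-1}(1-|\phi|^2)/|z-\phi|^2$ on $\partial D$ with respect to arc length. *)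

(* Defs.v *)
From HB Require Import structures.
From mathcomp Require Import all_boot all_order all_algebra.
From mathcomp Require Import all_classical all_reals all_analysis.
From mathcomp.real_closed Require Import complex.
Set Implicit Arguments. Unset Strict Implicit. Unset Printing Implicit Defensive.
Import Order.TTheory GRing.Theory Num.Theory.
Local Open Scope ring_scope.
Notation normc := ComplexField.Normc.normc.

Definition circ (R : realType) (t : R) : R[i] := (cos t +i* sin t)%C.

(* Density of the first exit point from the unit disc of planar Brownian
   motion started at phi, w.r.t. arc length, evaluated at circ t:
   (2 pi)^-1 (1 - |phi|^2) / |z - phi|^2. *)
Definition exit_density (R : realType) (phi : R[i]) (t : R) : R :=
  (2 * pi)^-1 * ((1 - normc phi ^+ 2) / normc (circ t - phi) ^+ 2).

Definition cond_density (R : realType) (phi1 phi2 : R[i]) (t : R) : R :=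
  (2 * pi)^-1
  * (normc (1 - phi1 * conjc phi2) ^+ 2 / (1 - normc (phi1 * conjc phi2) ^+ 2))
  * ((1 - normc phi1 ^+ 2) / normc (circ t - phi1) ^+ 2)
  * ((1 - normc phi2 ^+ 2) / normc (circ t - phi2) ^+ 2).

(* Main.v *)
Require Import Defs.
From HB Require Import structures.
From mathcomp Require Import all_boot all_order all_algebra.
From mathcomp Require Import all_classical all_reals all_analysis.
From mathcomp.real_closed Require Import complex.
From mathcomp Require Import measurable_realfun ring lra.
Import Order.TTheory GRing.Theory Num.Theory numFieldNormedType.Exports.
Local Open Scope classical_set_scope.
Local Open Scope ring_scope.
Set Implicit Arguments. Unset Strict Implicit. Unset Printing Implicit Defensive.

(** The arguments of Z_1 and Z_2 have densities p_1, p_2 that are Lipschitz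
    functions of the point of the circle. By Fubini the probability of
    {Z_1 in A, |Z_1 - Z_2| < e} is the integral over A of p_1(s) times the mass
    given by p_2 to the arc of radius e around s. By rotation invariance the
    length h(e) of that arc does not depend on s, so this probability is
    h(e) (int_A p_1 p_2 + O(e)), and dividing by the case where A is the whole
    circle cancels h(e) without computing it.

    The normalising constant int p_1 p_2 comes from writing the Poisson kernel
    as 2 Re q - 1, with q(z) = 1 / (1 - conj(phi) z) a Cauchy kernel. The
    integrals of q_1, q_2 and q_1 q_2 are 2 pi, their value at z = 0 times the
    length of the circle, and q_1 conj(q_2) = (q_1 + conj(q_2) - 1) / (1 - c)
    because c = (conj(phi1) z) (phi2 conj(z)) does not depend on z. *)

(** * Complex norms and points of the unit circle *)

Section unit_circle.
Context {R : realType}.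
Implicit Types (s t : R) (z phi : R[i]).

Lemma normc_ge0 z : 0 <= normc z.
Proof. by case: z => a b; exact: sqrtr_ge0. Qed.

Lemma sqr_normcE z : normc z ^+ 2 = complex.Re z ^+ 2 + complex.Im z ^+ 2.
Proof. by case: z => a b /=; rewrite sqr_sqrtr// addr_ge0// sqr_ge0. Qed.

Lemma normcJ z : normc (conjc z) = normc z.
Proof. by case: z => a b /=; rewrite sqrrN. Qed.

Lemma normcX z n : normc (z ^+ n) = normc z ^+ n.
Proof.
elim: n => [|n IH]; first by rewrite !expr0 ComplexField.Normc.normc1.
by rewrite !exprS ComplexField.Normc.normcM IH.
Qed.

Lemma normc_ge_abs z : `|complex.Re z| <= normc z /\ `|complex.Im z| <= normc z.
Proof.
by split; rewrite -(@ler_pXn2r _ 2)// ?nnegrE ?normr_ge0 ?normc_ge0//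
  real_normK ?num_real// sqr_normcE ?lerDl ?lerDr sqr_ge0.
Qed.

Lemma normc_le_abs z : normc z <= `|complex.Re z| + `|complex.Im z|.
Proof.
rewrite -(@ler_pXn2r _ 2)// ?nnegrE ?addr_ge0 ?normr_ge0 ?normc_ge0//.
rewrite sqr_normcE sqrrD !real_normK ?num_real// lerD2r lerDl.
by rewrite mulrn_wge0// mulr_ge0.
Qed.

Lemma normc_circ t : normc (circ t) = 1.
Proof.
apply/eqP; rewrite -(@eqrXn2 _ 2)// ?normc_ge0// sqr_normcE /= expr1n.
by rewrite cos2Dsin2.
Qed.

Lemma circJ t : circ t * conjc (circ t) = 1.
Proof.
have := cos2Dsin2 t.
by rewrite /circ => h; simpc; rewrite -!expr2 h mulrC addrC subrr.
Qed.

Lemma circXn n t : circ t ^+ n = circ (n%:R * t).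
Proof.
elim: n => [|n IH]; first by rewrite expr0 mul0r /circ cos0 sin0.
by rewrite exprSr IH -natr1 mulrDl mul1r /circ cosD sinD; simpc; congr (_ +i* _)%C;
  ring.
Qed.

(** The law of cosines on the unit circle: chord length depends only on [s - t], which is the source
    of the rotation invariance of arcs. *)
Lemma sqr_normc_circB s t : normc (circ s - circ t) ^+ 2 = 2 - 2 * cos (s - t).
Proof.
rewrite sqr_normcE /= cosB.
have := cos2Dsin2 s; have := cos2Dsin2 t; rewrite !expr2; nra.
Qed.

Lemma normc_circB_lt s t (e : R) : 0 < e ->
  (normc (circ s - circ t) < e) = (1 - e ^+ 2 / 2 < cos (s - t)).
Proof.
move=> e0; rewrite -(@ltr_pXn2r _ 2)// ?nnegrE ?normc_ge0 ?ltW//.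
by rewrite sqr_normc_circB; apply/idP/idP; lra.
Qed.

Lemma ler_dist_normc z w : `|normc z - normc w| <= normc (z - w).
Proof.
rewrite ler_norml; apply/andP; split.
  have := @le_normcD R (w - z) z.
  by rewrite subrK -(normcN (w - z)) opprB; lra.
by have := @le_normcD R (z - w) w; rewrite subrK; lra.
Qed.

Lemma normc_circB_ge phi t : 1 - normc phi <= normc (circ t - phi).
Proof.
apply: le_trans (ler_dist_normc _ _).
by rewrite normc_circ ler_norm.
Qed.

Lemma normc_circB_le phi t : normc (circ t - phi) <= 1 + normc phi.
Proof. by rewrite (le_trans (le_normcD _ _))// normc_circ normcN. Qed.

Lemma normc_sqr_lt1 phi : normc phi < 1 -> 0 < 1 - normc phi ^+ 2.
Proof. by have := normc_ge0 phi => h0 h1; rewrite subr_gt0 expr_lt1. Qed.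

Lemma exit_density_gt0 phi t : normc phi < 1 -> 0 < exit_density phi t.
Proof.
move=> phi1; have m0 : 0 < normc (circ t - phi).
  by rewrite (lt_le_trans _ (normc_circB_ge _ _))// subr_gt0.
by rewrite /exit_density !(mulr_gt0, invr_gt0, exprn_gt0, pi_gt0, normc_sqr_lt1).
Qed.

(** The denominator stays away from 0 since the pole [phi] is at distance at least [1 - normc phi]
    from the circle. The increment is measured by the chord, the quantity that the conditioning
    event controls. *)
Lemma exit_density_lip phi : normc phi < 1 -> exists2 L : R, 0 <= L &
  forall s t, `|exit_density phi t - exit_density phi s| <=
              L * normc (circ s - circ t).
Proof.
move=> phi1; set m := 1 - normc phi.
have m0 : 0 < m by rewrite subr_gt0.
pose k := (2 * pi)^-1 * (1 - normc phi ^+ 2) : R.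
have k0 : 0 <= k.
  by rewrite mulr_ge0 ?ltW ?normc_sqr_lt1// invr_gt0 mulr_gt0 ?pi_gt0.
(* Here [4] bounds [u + v], as both distances are at most 2, and [m ^+ 4] bounds [u ^+ 2 * v ^+ 2]
   from below. *)
exists (k * (4 / m ^+ 4)).
  by rewrite mulr_ge0// divr_ge0// exprn_ge0// ltW.
move=> s t; rewrite /exit_density !mulrA -/k -mulrBr normrM (ger0_norm k0).
rewrite -!(mulrA k) ler_wpM2l//.
set u := normc (circ t - phi); set v := normc (circ s - phi).
have mu : m <= u by exact: normc_circB_ge.
have mv : m <= v by exact: normc_circB_ge.
have u2 : u <= 2 by rewrite (le_trans (normc_circB_le _ _))//; lra.
have v2 : v <= 2 by rewrite (le_trans (normc_circB_le _ _))//; lra.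
have u0 : 0 < u by exact: lt_le_trans mu.
have v0 : 0 < v by exact: lt_le_trans mv.
have uv : `|v - u| <= normc (circ s - circ t).
  by rewrite (le_trans (ler_dist_normc _ _))// opprB addrA subrK.
have -> : (u ^+ 2)^-1 - (v ^+ 2)^-1 = (u + v) / (u ^+ 2 * v ^+ 2) * (v - u).
  by field; rewrite !gt_eqF.
have uv0 : 0 < u ^+ 2 * v ^+ 2 by rewrite mulr_gt0// exprn_gt0.
have q0 : 0 <= (u + v) / (u ^+ 2 * v ^+ 2).
  by rewrite divr_ge0 ?ltW// addr_gt0.
rewrite normrM (ger0_norm q0) ler_pM// ler_pM//.
- by rewrite addr_ge0// ltW.
- by rewrite invr_ge0 ltW.
- lra.
- rewrite lef_pV2 ?posrE// ?exprn_gt0//.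
  by rewrite -[4%N]/(2 + 2)%N exprD ler_pM// ?exprn_ge0// ?lerXn2r// ?nnegrE ltW.
Qed.

End unit_circle.

(** * Densities and translations *)

Section density.
Local Open Scope ereal_scope.
Context d (T : measurableType d) (R : realType).
Variables (mu nu : {measure set T -> \bar R}) (g : T -> R).
Hypotheses (mg : measurable_fun setT g) (g0 : forall x, (0 <= g x)%R).
Hypothesis nuE : forall A, measurable A -> nu A = \int[mu]_(x in A) (g x)%:E.

Import HBNNSimple.

(** Both sides are monotone limits over nonnegative simple functions. By linearity these reduce to
    indicators of level sets, where the identity is [nuE]. *)
Lemma ge0_integral_density (D : set T) (f : T -> \bar R) :
  measurable D -> measurable_fun D f -> (forall x, D x -> 0 <= f x) ->
  \int[nu]_(x in D) f x = \int[mu]_(x in D) (f x * (g x)%:E).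
Proof.
move=> mD mf f0; pose h := nnsfun_approx mD mf.
have cvh x : D x -> (h n x)%:E @[n --> \oo] --> f x.
  by move=> Dx; apply: cvg_nnsfun_approx.
have mE : measurable_fun D (EFin \o g).
  by apply/measurable_EFinP; exact: measurable_funTS.
have -> : \int[nu]_(x in D) f x = limn (fun n => \int[nu]_(x in D) (h n x)%:E).
  rewrite -monotone_convergence//.
  - by apply: eq_integral => x /[!inE] Dx; apply/esym/cvg_lim => //; exact: cvh.
  - by move=> n; apply/measurable_EFinP; exact: measurable_funTS.
  - by move=> n x _; rewrite lee_fin.
  - by move=> x _ a b ab; rewrite lee_fin; exact/lefP/nd_nnsfun_approx.
have -> : \int[mu]_(x in D) (f x * (g x)%:E) =
    limn (fun n => \int[mu]_(x in D) ((h n x)%:E * (g x)%:E)).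
  rewrite -monotone_convergence//.
  - apply: eq_integral => x /[!inE] Dx; apply/esym/cvg_lim => //.
    by apply: cvgeZr => //; exact: cvh.
  - move=> n; apply: emeasurable_funM => //.
    by apply/measurable_EFinP; exact: measurable_funTS.
  - by move=> n x _; rewrite mule_ge0// lee_fin.
  - move=> x _ a b ab; rewrite lee_wpmul2r ?lee_fin//.
    exact/lefP/nd_nnsfun_approx.
congr (limn _); apply/funext => n.
under eq_integral do rewrite fimfunE -fsumEFin//.
rewrite ge0_integral_fsum//; last 2 first.
  - move=> y; apply/measurable_EFinP; apply: measurable_funTS.
    exact: measurable_funM.
  - by move=> y x _; exact: nnfun_muleindic_ge0.
under [RHS]eq_integral => x _.
  rewrite fimfunE -fsumEFin// ge0_mule_fsuml; last first.
    by move=> y; exact: nnfun_muleindic_ge0.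
  over.
rewrite ge0_integral_fsum//; last 2 first.
  - move=> y; apply: emeasurable_funM => //; apply/measurable_EFinP.
    by apply: measurable_funTS; exact: measurable_funM.
  - by move=> y x _; rewrite mule_ge0 ?lee_fin//; exact: nnfun_muleindic_ge0.
(* The sum runs over the range of [h n], so [r] is an attained value and hence nonnegative. *)
apply: eq_fsbigr => r /[!inE] -[x0 _ <-].
have r0 : (0 <= (h n x0)%:E) by rewrite lee_fin.
have mh : measurable (h n @^-1` [set h n x0]) by [].
have mI : measurable_fun D (EFin \o (\1_(h n @^-1` [set h n x0]) : T -> R)).
  by apply/measurable_EFinP; exact: measurable_indic.
under eq_integral do rewrite EFinM.
under [RHS]eq_integral do rewrite EFinM -muleA.
rewrite !ge0_integralZl//; last 2 first.
- exact: emeasurable_funM.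
- by move=> x _; rewrite mule_ge0// lee_fin.
congr (_ * _); rewrite integral_indic// setIC nuE; last exact: measurableI.
rewrite integral_mkcondr; apply: eq_integral => x _.
by rewrite epatch_indic /= muleC.
Qed.

End density.

Section translation.
Context {R : realType}.
Local Notation mu := (@lebesgue_measure R).

(** The image measure under the translation has the same value as [mu] on half-open intervals, and
    Lebesgue measure is determined by these. *)
Lemma lebesgue_measure_shift (a : R) (A : set R) : measurable A ->
  mu ((fun x => x + a) @^-1` A) = mu A.
Proof.
move=> mA; pose f : measurableTypeR R -> measurableTypeR R := fun x => x + a.
have mf : measurable_fun setT f by apply: measurable_funD.
pose F := HB.pack_for {mfun measurableTypeR R >-> measurableTypeR R} f
  (isMeasurableFun.Build _ _ _ _ _ mf).
suff : mu A = pushforward mu F A by move=> ->.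
apply: (lebesgue_measure_unique (mu := pushforward mu F)) => //= _ [[x y]] _ <-.
rewrite /pushforward /F/=.
have -> : f @^-1` `]x, y] = `](x - a), (y - a)]%classic.
  apply/seteqP; split => z /=; rewrite !in_itv/= /f => /andP[? ?];
    by apply/andP; split; lra.
rewrite !lebesgue_measure_itv/= !lte_fin ltrD2r.
by case: ifP => // _; rewrite -!EFinB; congr EFin; ring.
Qed.

(** Translating moves the window to [[- s, p - s[]. Its part left of 0 is carried by one period onto
    [[p - s, p[], which restores the original window. *)
Lemma lebesgue_measure_period (p s : R) (S : set R) : measurable S ->
  (forall x, S (x + p) <-> S x) -> 0 <= s <= p ->
  mu ((fun x => x - s) @^-1` S `&` `[0, p[) = mu (S `&` `[0, p[).
Proof.
move=> mS per /andP[s0 sp].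
have mI (a b : R) : measurable (S `&` `[a, b[) by exact: measurableI.
have split_at (q a b : R) : a <= q -> q <= b ->
    mu (S `&` `[a, b[) = (mu (S `&` `[a, q[) + mu (S `&` `[q, b[))%E.
  move=> aq qb; rewrite -measureU//; [|exact: mI|exact: mI|].
    rewrite -setIUr; congr (mu (_ `&` _)).
    apply/seteqP; split => x /=; rewrite !in_itv/=.
      by case: (ltP x q) => ? ?; [left|right]; lra.
    by case; lra.
  by apply/seteqP; split => // x /= -[[_ +] [_]]; rewrite !in_itv/=; lra.
have -> : (fun x => x - s) @^-1` S `&` `[0, p[ =
    (fun x => x + - s) @^-1` (S `&` `[- s, p - s[).
  by apply/seteqP; split => x /=; rewrite !in_itv/= => -[? ?]; split => //; lra.
rewrite lebesgue_measure_shift//.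
rewrite (split_at 0); [|lra|lra].
rewrite [RHS](split_at (p - s)); [|lra|lra].
(* The piece over [[0, p - s[] is common to both sides; the remaining two differ by a translation by
   [p]. *)
rewrite addeC; congr (_ + _)%E.
rewrite -[RHS](lebesgue_measure_shift p)//; congr (mu _).
apply/seteqP; split => x /=; rewrite !in_itv/= => -[? ?].
  by split; [exact/per|lra].
by split; [exact/per|lra].
Qed.

End translation.

(** * Integrals of complex functions over the circle *)

Section circle_mean.
Context {R : realType}.
Implicit Types (f g : R -> R[i]) (psi phi : R[i]).
Local Notation mu := (@lebesgue_measure R).
Local Notation I := (`[0, (2 * pi : R)[%classic).

Lemma measure_period_itv : mu I = (2 * pi)%:E.
Proof. by rewrite lebesgue_measure_itv/= lte_fin mulr_gt0 ?pi_gt0// oppr0 addr0. Qed.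

Lemma continuous_integrable_period (f : R -> R) : continuous f ->
  mu.-integrable I (EFin \o f).
Proof.
move=> cf; have sub : I `<=` `[0, 2 * pi]%classic.
  by apply: subset_itvl; rewrite bnd_simp.
have : mu.-integrable `[0, 2 * pi] (EFin \o f).
  apply: continuous_compact_integrable; first exact: segment_compact.
  exact: continuous_subspaceT.
by apply: integrableS.
Qed.

Lemma integrable_setI_period (A : set R) (f : R -> R) : measurable A ->
  continuous f -> mu.-integrable (A `&` I) (EFin \o f).
Proof.
move=> mA /continuous_integrable_period.
by apply: integrableS => //; exact: measurableI.
Qed.

Lemma Rintegral_cst_period (k : R) : \int[mu]_(t in I) k = k * (2 * pi).
Proof.
rewrite Rintegral_cst//; congr (_ * _).
exact: (congr1 fine measure_period_itv).
Qed.

(** Componentwise, to match [cintegral]: integrability is then a statement about two real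
    functions. *)
Definition ccontinuous f :=
  continuous (fun t => complex.Re (f t)) /\ continuous (fun t => complex.Im (f t)).

Lemma ccontinuous_cst (c : R[i]) : ccontinuous (fun=> c).
Proof. by split => t; exact: cvg_cst. Qed.

Lemma ccontinuous_circ : ccontinuous (@circ R).
Proof. by split => t; [exact: continuous_cos|exact: continuous_sin]. Qed.

Lemma ccontinuousD f g : ccontinuous f -> ccontinuous g ->
  ccontinuous (fun t => f t + g t).
Proof.
have ReD (z w : R[i]) : complex.Re (z + w) = complex.Re z + complex.Re w.
  by case: z w => [? ?] [? ?].
have ImD (z w : R[i]) : complex.Im (z + w) = complex.Im z + complex.Im w.
  by case: z w => [? ?] [? ?].
move=> [f1 f2] [g1 g2]; split => t.
  by under eq_fun do rewrite ReD; apply: cvgD; [exact: f1|exact: g1].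
by under eq_fun do rewrite ImD; apply: cvgD; [exact: f2|exact: g2].
Qed.

Lemma ccontinuousM f g : ccontinuous f -> ccontinuous g ->
  ccontinuous (fun t => f t * g t).
Proof.
have ReM (z w : R[i]) : complex.Re (z * w) =
  complex.Re z * complex.Re w - complex.Im z * complex.Im w.
  by case: z w => [? ?] [? ?].
have ImM (z w : R[i]) : complex.Im (z * w) =
  complex.Re z * complex.Im w + complex.Im z * complex.Re w.
  by case: z w => [? ?] [? ?].
move=> [f1 f2] [g1 g2]; split => t; rewrite /=.
  under eq_fun do rewrite ReM.
  by apply: cvgB; apply: cvgM; [exact: f1|exact: g1|exact: f2|exact: g2].
under eq_fun do rewrite ImM.
by apply: cvgD; apply: cvgM; [exact: f1|exact: g2|exact: f2|exact: g1].
Qed.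

Lemma ccontinuousN f : ccontinuous f -> ccontinuous (fun t => - f t).
Proof.
move=> cf; under eq_fun do rewrite -mulN1r.
exact: ccontinuousM (ccontinuous_cst _) cf.
Qed.

Lemma ccontinuousX f n : ccontinuous f -> ccontinuous (fun t => f t ^+ n).
Proof.
move=> cf; elim: n => [|n IH]; first exact: ccontinuous_cst.
by under eq_fun do rewrite exprS; exact: ccontinuousM.
Qed.

Lemma ccontinuousJ f : ccontinuous f -> ccontinuous (fun t => conjc (f t)).
Proof.
have ReJ (z : R[i]) : complex.Re (conjc z) = complex.Re z by case: z.
have ImJ (z : R[i]) : complex.Im (conjc z) = - complex.Im z by case: z.
move=> [f1 f2]; split => t.
  by under eq_fun do rewrite ReJ; exact: f1.
by under eq_fun do rewrite ImJ; apply: cvgN; exact: f2.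
Qed.

(** The inverse is the conjugate divided by the squared modulus, and the latter is continuous and
    never 0. *)
Lemma ccontinuousV f : (forall t, f t != 0) -> ccontinuous f ->
  ccontinuous (fun t => (f t)^-1).
Proof.
have ReV (z : R[i]) : complex.Re z^-1 =
    complex.Re z * (complex.Re z ^+ 2 + complex.Im z ^+ 2)^-1 by case: z.
have ImV (z : R[i]) : complex.Im z^-1 =
    - (complex.Im z * (complex.Re z ^+ 2 + complex.Im z ^+ 2)^-1) by case: z.
move=> f0 [f1 f2].
have den t : complex.Re (f s) ^+ 2 + complex.Im (f s) ^+ 2 @[s --> t] -->
             complex.Re (f t) ^+ 2 + complex.Im (f t) ^+ 2.
  by rewrite !expr2; apply: cvgD; apply: cvgM; (exact: f1 || exact: f2).
have denV t : (complex.Re (f s) ^+ 2 + complex.Im (f s) ^+ 2)^-1 @[s --> t] -->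
             (complex.Re (f t) ^+ 2 + complex.Im (f t) ^+ 2)^-1.
  apply: cvgV; last exact: den.
  apply: contra (f0 t); rewrite paddr_eq0 ?sqr_ge0// !sqrf_eq0.
  by case: (f t) => a b /= /andP[/eqP -> /eqP ->].
split => t.
  by under eq_fun do rewrite ReV; apply: cvgM; [exact: f1|exact: denV].
under eq_fun do rewrite ImV; apply: cvgN.
by apply: cvgM; [exact: f2|exact: denV].
Qed.

Definition cintegral f : R[i] :=
  ((\int[mu]_(t in I) complex.Re (f t)) +i* (\int[mu]_(t in I) complex.Im (f t)))%C.

Lemma eq_cintegral f g : f =1 g -> cintegral f = cintegral g.
Proof. by move=> /funext ->. Qed.

Lemma cintegralD f g : ccontinuous f -> ccontinuous g ->
  cintegral (fun t => f t + g t) = cintegral f + cintegral g.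
Proof.
move=> [f1 f2] [g1 g2]; rewrite /cintegral; simpc.
rewrite -!RintegralD//; try exact: continuous_integrable_period.
by congr (_ +i* _)%C; apply: eq_Rintegral => t _; case: (f t) (g t) => [? ?] [? ?].
Qed.

Lemma cintegralZ (c : R[i]) f : ccontinuous f ->
  cintegral (fun t => c * f t) = c * cintegral f.
Proof.
move=> [f1 f2]; rewrite /cintegral; case: c => a b; simpc.
have i1 := continuous_integrable_period f1.
have i2 := continuous_integrable_period f2.
have cZ (k : R) (h : R -> R) : continuous h -> continuous (fun t => k * h t).
  by move=> ch t; apply: cvgMr; exact: ch.
rewrite -!RintegralZl// -RintegralB//; try exact/continuous_integrable_period/cZ.
rewrite -RintegralD//; try exact/continuous_integrable_period/cZ.
by congr (_ +i* _)%C; apply: eq_Rintegral => t _; case: (f t) => x y; simpc.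
Qed.

Lemma cintegralJ f : ccontinuous f ->
  cintegral (fun t => conjc (f t)) = conjc (cintegral f).
Proof.
move=> [f1 f2]; rewrite /cintegral /=; congr (_ +i* _)%C.
  by apply: eq_Rintegral => t _; case: (f t).
have i2 := continuous_integrable_period f2.
rewrite -mulN1r -RintegralZl//.
by apply: eq_Rintegral => t _; case: (f t) => a b; rewrite mulN1r.
Qed.

Lemma cintegral1 : cintegral (fun=> 1) = (2 * pi)%:C%C.
Proof.
by rewrite /cintegral/= !Rintegral_cst_period mul0r mul1r.
Qed.

(** Each component contributes at most [2 * pi * M]. The constant is not sharp, but any finite bound
    will do, since it gets multiplied by a power of [normc psi] tending to 0. *)
Lemma normc_cintegral f (M : R) : ccontinuous f -> (forall t, normc (f t) <= M) ->
  normc (cintegral f) <= 4 * pi * M.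
Proof.
move=> [f1 f2] fM.
have H (h : R -> R) : continuous h -> (forall t, `|h t| <= M) ->
    `|\int[mu]_(t in I) h t| <= 2 * pi * M.
  move=> ch hM; apply: (le_trans (le_normr_Rintegral _ _)) => //.
    exact: continuous_integrable_period.
  rewrite [leRHS]mulrC -Rintegral_cst_period.
  apply: le_Rintegral => //.
  - apply: continuous_integrable_period => t.
    by apply: cvg_norm; exact: ch.
  - by apply: continuous_integrable_period => t; exact: cvg_cst.
have -> : 4 * pi * M = 2 * pi * M + 2 * pi * M by ring.
rewrite (le_trans (normc_le_abs _))//= lerD// H// => t.
  by have [+ _] := normc_ge_abs (f t); move/le_trans; apply.
by have [_ +] := normc_ge_abs (f t); move/le_trans; apply.
Qed.

(** The components have antiderivatives [sin (m t) / m] and [- cos (m t) / m], which are periodic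
    and so take equal values at 0 and [2 * pi]. *)
Lemma cintegral_circX m : (0 < m)%N -> cintegral (fun t => circ t ^+ m) = 0.
Proof.
move=> m0; have mR : (m%:R : R) != 0 by rewrite pnatr_eq0 -lt0n.
have cm : continuous (fun t : R => m%:R * t).
  by move=> t; apply: cvgMr; exact: cvg_id.
have csin : continuous (fun t : R => sin (m%:R * t)).
  by move=> t; apply: continuous_comp; [exact: cm|exact: continuous_sin].
have ccos : continuous (fun t : R => cos (m%:R * t)).
  by move=> t; apply: continuous_comp; [exact: cm|exact: continuous_cos].
have per : circ (m%:R * (2 * pi) : R) = 1.
  rewrite -circXn (_ : circ _ = 1) ?expr1n//.
  by rewrite /circ mulrC mulr_natr cos2pi sin2pi.
have pi20 : 0 < 2 * pi :> R by rewrite mulr_gt0 ?pi_gt0.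
have FTC (F h : R -> R) : continuous h ->
    (forall t : R, is_derive t (1 : R) F (h t)) ->
    F (2 * pi) = F 0 -> \int[mu]_(t in I) h t = 0.
  move=> ch dF per0.
  have cF : continuous F.
    by move=> t; apply/differentiable_continuous/derivable1_diffP; have [] := dF t.
  rewrite Rintegral_itv_bndo_bndc; last exact: continuous_integrable_period.
  rewrite /Rintegral (@continuous_FTC2 _ h F)//.
  - by rewrite per0 subee.
  - exact: continuous_subspaceT.
  - split.
    + by move=> t _; have [] := dF t.
    + by apply: cvg_at_right_filter; exact: cF.
    + by apply: cvg_at_left_filter; exact: cF.
  - by move=> t _; rewrite derive1E; have [_ ->] := dF t.
have circE t : circ t ^+ m = (cos (m%:R * t) +i* sin (m%:R * t))%C.
  by rewrite circXn.
move: per => [perc pers].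
rewrite /cintegral; congr (_ +i* _)%C.
  under eq_Rintegral do rewrite circE /=.
  apply: (FTC (fun t => m%:R^-1 * sin (m%:R * t))) => // [t|].
    by apply: is_derive_eq; rewrite /GRing.scale/=; field.
  by rewrite pers !mulr0 sin0 mulr0.
under eq_Rintegral do rewrite circE /=.
apply: (FTC (fun t => - m%:R^-1 * cos (m%:R * t))) => // [t|].
  by apply: is_derive_eq; rewrite /GRing.scale/=; field.
by rewrite perc mulr0 cos0.
Qed.

End circle_mean.

(** * Cauchy and Poisson kernels *)

Section cauchy.
Context {R : realType}.
Implicit Types (f g : R -> R[i]) (psi phi : R[i]).
Local Notation mu := (@lebesgue_measure R).
Local Notation I := (`[0, (2 * pi : R)[%classic).

(** For [normc psi < 1] this is the sum of the geometric series in [psi * circ t]. The Poisson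
    kernel with pole parameter [phi] uses [psi = conjc phi]. *)
Definition cauchy_kernel psi (t : R) : R[i] := (1 - psi * circ t)^-1.

Lemma cauchy_den_ge psi (t : R) : 1 - normc psi <= normc (1 - psi * circ t).
Proof.
apply: le_trans (ler_dist_normc _ _).
by rewrite ComplexField.Normc.normcM normc_circ mulr1 ComplexField.Normc.normc1
  ler_norm.
Qed.

Lemma cauchy_den_neq0 psi (t : R) : normc psi < 1 -> 1 - psi * circ t != 0.
Proof.
move=> psi1; apply/eqP => h; have := cauchy_den_ge psi t.
by rewrite h ComplexField.Normc.normc0 leNgt subr_gt0 psi1.
Qed.

Lemma ccontinuous_cauchy psi : normc psi < 1 -> ccontinuous (cauchy_kernel psi).
Proof.
move=> psi1; apply: ccontinuousV; first by move=> t; exact: cauchy_den_neq0.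
apply: ccontinuousD; first exact: ccontinuous_cst.
apply: ccontinuousN; apply: ccontinuousM; first exact: ccontinuous_cst.
exact: ccontinuous_circ.
Qed.

Lemma normc_cauchy_le psi (t : R) : normc psi < 1 ->
  normc (cauchy_kernel psi t) <= (1 - normc psi)^-1.
Proof.
move=> psi1; rewrite /cauchy_kernel ComplexField.Normc.normcV lef_pV2 ?posrE//.
- exact: cauchy_den_ge.
- by rewrite (lt_le_trans _ (cauchy_den_ge _ _))// subr_gt0.
- by rewrite subr_gt0.
Qed.

(* The moments W_m of g q, q the Cauchy kernel, satisfy W_m = psi W_(m+1) for
   m > 0, hence |W_m| <= C |psi|^k for all k. *)
Lemma cauchy_moments psi g (M : R) : normc psi < 1 -> ccontinuous g ->
  (forall t, normc (g t) <= M) ->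
  (forall m, (0 < m)%N -> cintegral (fun t => circ t ^+ m * g t) = 0) ->
  (forall m, (0 < m)%N ->
     cintegral (fun t => circ t ^+ m * (g t * cauchy_kernel psi t)) = 0) /\
  cintegral (fun t => g t * cauchy_kernel psi t) = cintegral g.
Proof.
move=> psi1 cg gM V0.
pose W m := cintegral (fun t => circ t ^+ m * (g t * cauchy_kernel psi t)).
have cgq : ccontinuous (fun t => g t * cauchy_kernel psi t).
  by apply: ccontinuousM => //; exact: ccontinuous_cauchy.
have cz m : ccontinuous (fun t : R => circ t ^+ m).
  by apply: ccontinuousX; exact: ccontinuous_circ.
have cW m : ccontinuous (fun t => circ t ^+ m * (g t * cauchy_kernel psi t)).
  exact: ccontinuousM.
(* This is the identity [q = 1 + psi z q] for the Cauchy kernel [q], multiplied by [z ^+ m * g] and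
   integrated. *)
have rec m : W m = cintegral (fun t => circ t ^+ m * g t) + psi * W m.+1.
  rewrite -cintegralZ// -cintegralD//; last 2 first.
  - exact: ccontinuousM.
  - by apply: ccontinuousM => //; exact: ccontinuous_cst.
  apply: eq_cintegral => t; have q0 := cauchy_den_neq0 t psi1.
  rewrite /cauchy_kernel exprS.
  by field.
have W0 m : (0 < m)%N -> W m = 0.
  move=> m0.
  have iter k : W m = psi ^+ k * W (m + k)%N.
    elim: k => [|k IH]; first by rewrite expr0 mul1r addn0.
    by rewrite IH rec V0 ?add0r ?addn_gt0 ?m0// exprSr addnS mulrA.
  (* One bound for all moments, because [normc (circ t) = 1] makes the power of [z] disappear from
     the estimate. *)
  pose C := 4 * pi * (M * (1 - normc psi)^-1).
  have bnd k : normc (W m) <= C * normc psi ^+ k.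
    rewrite (iter k) ComplexField.Normc.normcM normcX mulrC.
    rewrite ler_wpM2r ?exprn_ge0 ?normc_ge0//.
    apply: normc_cintegral => // t.
    rewrite !ComplexField.Normc.normcM normcX normc_circ expr1n mul1r.
    by rewrite ler_pM ?normc_ge0// normc_cauchy_le.
  apply: ComplexField.Normc.eq0_normc; apply/eqP; rewrite eq_le normc_ge0 andbT.
  have lim0 : C * normc psi ^+ k @[k --> \oo] --> (0 : R).
    rewrite -(mulr0 C); apply: cvgMr; apply: cvg_expr.
    by rewrite ger0_norm ?normc_ge0.
  rewrite -(cvg_lim _ lim0)//; apply: limr_ge.
    by apply/cvg_ex; exists 0.
  by apply: nearW.
split => //.
(* At index 0 the recursion involves the moment of index 1, already known to vanish, so only the
   integral of [g] is left. *)
have := rec 0%N; rewrite (W0 1%N)// mulr0 addr0 /W.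
under eq_cintegral do rewrite expr0 mul1r.
by under [in X in _ = X -> _]eq_cintegral do rewrite expr0 mul1r.
Qed.

Lemma cintegral_cauchy psi : normc psi < 1 ->
  cintegral (cauchy_kernel psi) = (2 * pi)%:C%C.
Proof.
move=> psi1; rewrite -cintegral1.
have [||m m0|_ <-] := @cauchy_moments psi (fun=> 1) 1 psi1.
- exact: ccontinuous_cst.
- by move=> t; rewrite ComplexField.Normc.normc1.
- by under eq_cintegral do rewrite mulr1; exact: cintegral_circX.
- by under [RHS]eq_cintegral do rewrite mul1r.
Qed.

(** [cauchy_moments] is used twice. With [g = 1] it shows that the positive moments of the first
    kernel vanish; this is what allows [g] to be that kernel in the second use. *)
Lemma cintegral_cauchyM psi1 psi2 : normc psi1 < 1 -> normc psi2 < 1 ->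
  cintegral (fun t => cauchy_kernel psi1 t * cauchy_kernel psi2 t) =
  (2 * pi)%:C%C.
Proof.
move=> h1 h2; rewrite -(cintegral_cauchy h1).
have [||m m0|_ <-//] := @cauchy_moments psi2 (cauchy_kernel psi1)
  (1 - normc psi1)^-1 h2.
- exact: ccontinuous_cauchy.
- by move=> t; exact: normc_cauchy_le.
- have [||k k0|+ _] := @cauchy_moments psi1 (fun=> 1) 1 h1.
  + exact: ccontinuous_cst.
  + by move=> t; rewrite ComplexField.Normc.normc1.
  + by under eq_cintegral do rewrite mulr1; exact: cintegral_circX.
  + by move=> /(_ m m0); under eq_cintegral do rewrite mul1r.
Qed.

Definition poisson phi (t : R) : R :=
  (1 - normc phi ^+ 2) / normc (circ t - phi) ^+ 2.

(** The left side is the real part of [(1 + w) / (1 - w)]. It serves twice: for the Poisson kernel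
    with [w = conjc phi * circ t], and for the normalising constant with [w = c]. *)
Lemma Re_inv1B (w : R[i]) : w != 1 ->
  2 * complex.Re (1 - w)^-1 - 1 = (1 - normc w ^+ 2) / normc (1 - w) ^+ 2.
Proof.
move=> w1; have : normc (1 - w) ^+ 2 != 0.
  rewrite expf_eq0/=; apply: contra w1 => /eqP/ComplexField.Normc.eq0_normc/eqP.
  by rewrite subr_eq0 eq_sym.
rewrite !sqr_normcE; case: w {w1} => a b /=.
by rewrite !expr2 !sub0r => h; field.
Qed.

Lemma poissonE phi (t : R) : normc phi < 1 ->
  poisson phi t = 2 * complex.Re (cauchy_kernel (conjc phi) t) - 1.
Proof.
move=> phi1; have := @cauchy_den_neq0 (conjc phi) t; rewrite normcJ => /(_ phi1).
rewrite subr_eq0 eq_sym => w1; rewrite /cauchy_kernel Re_inv1B//.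
rewrite ComplexField.Normc.normcM normcJ normc_circ mulr1 /poisson.
(* On the circle, [|1 - conj(phi) z| = |1 - phi conj(z)| = |conj(z) (z - phi)| = |z - phi|]. *)
congr (_ / _ ^+ 2); rewrite -[RHS]normcJ rmorphB rmorph1 rmorphM /= conjcK.
rewrite -[LHS]mul1r -(normc_circ t) -[in LHS](normcJ (circ t)).
by rewrite -ComplexField.Normc.normcM mulrBr [conjc _ * circ t]mulrC circJ mulrC.
Qed.

Lemma integral_poissonM phi1 phi2 : normc phi1 < 1 -> normc phi2 < 1 ->
  \int[mu]_(t in I) (poisson phi1 t * poisson phi2 t) =
  2 * pi * ((1 - normc (phi1 * conjc phi2) ^+ 2) /
            normc (1 - phi1 * conjc phi2) ^+ 2).
Proof.
move=> h1 h2.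
pose A := cauchy_kernel (conjc phi1) : R -> R[i].
pose B := cauchy_kernel (conjc phi2) : R -> R[i].
pose c := conjc phi1 * phi2.
have n1 : normc (conjc phi1) < 1 by rewrite normcJ.
have n2 : normc (conjc phi2) < 1 by rewrite normcJ.
have c1 : c != 1.
  apply/eqP => h; have : normc c < 1.
    by rewrite ComplexField.Normc.normcM mulr_ilt1 ?normc_ge0.
  by rewrite h ComplexField.Normc.normc1 ltxx.
have cA : ccontinuous A by exact: ccontinuous_cauchy.
have cB : ccontinuous B by exact: ccontinuous_cauchy.
have cst (k : R[i]) := @ccontinuous_cst R k.
(* With [u = conj(phi1) z] and [v = phi2 conj(z)], this is [1/(1-u) + 1/(1-v) - 1 =
   (1-uv)/((1-u)(1-v))], where [uv = c]. *)
have ABJ t : A t * conjc (B t) = (1 - c)^-1 * (A t + conjc (B t) - 1).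
  have a0 : 1 - conjc phi1 * circ t != 0 by exact: cauchy_den_neq0.
  have JB : conjc (1 - conjc phi2 * circ t) = 1 - phi2 * conjc (circ t).
    by rewrite rmorphB rmorph1 rmorphM /= conjcK.
  have b0 : 1 - phi2 * conjc (circ t) != 0.
    by have := cauchy_den_neq0 t n2; rewrite -conjc_eq0 JB.
  have d0 : 1 - c != 0 by rewrite subr_eq0 eq_sym.
  have ab : c = (conjc phi1 * circ t) * (phi2 * conjc (circ t)).
    by rewrite mulrACA circJ mulr1.
  rewrite /A /B /cauchy_kernel conjc_inv JB.
  move: d0; rewrite ab => d0; field.
  by rewrite a0 b0 d0.
(* The product of [2 Re A - 1] and [2 Re B - 1] is the real part of
   [2AB + 2A conj(B) - 2A - 2B + 1]. In [F] the mixed term is already made linear by [ABJ]. *)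
pose F t := 2 * (A t * B t) + (2 * (1 - c)^-1 * (A t + (conjc (B t) + -1)) +
  (-2 * A t + (-2 * B t + 1))).
have IA : cintegral A = (2 * pi)%:C%C by exact: cintegral_cauchy.
have IB : cintegral B = (2 * pi)%:C%C by exact: cintegral_cauchy.
have IAB : cintegral (fun t => A t * B t) = (2 * pi)%:C%C.
  exact: cintegral_cauchyM.
have PA t : poisson phi1 t = 2 * complex.Re (A t) - 1 by exact: poissonE.
have PB t : poisson phi2 t = 2 * complex.Re (B t) - 1 by exact: poissonE.
(* [c] is the conjugate of [phi1 * conjc phi2], so the moduli agree. *)
have -> : normc (1 - phi1 * conjc phi2) = normc (1 - c).
  by rewrite -normcJ rmorphB rmorph1 rmorphM /= conjcK.
have -> : normc (phi1 * conjc phi2) = normc c.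
  by rewrite -normcJ rmorphM /= conjcK.
rewrite -Re_inv1B//.
clearbody A B c.
have PF t : poisson phi1 t * poisson phi2 t = complex.Re (F t).
  have -> : F t = 2 * (A t * B t) + (2 * (A t * conjc (B t)) +
      (-2 * A t + (-2 * B t + 1))).
    by rewrite ABJ /F; ring.
  rewrite PA PB; case: (A t) (B t) => [a a'] [b b'] /=.
  ring.
(* Each of [A], [B], [AB], [conj(B)] and 1 integrates to [2 * pi], which leaves the coefficient
   [2 + 2/(1-c) - 2 - 2 + 1]. *)
have IF : cintegral F = (2 * pi)%:C%C * (2 * (1 - c)^-1 - 1).
  have cBJ := ccontinuousJ cB.
  have cAB := ccontinuousM cA cB.
  have cZ (k : R[i]) f : ccontinuous f -> ccontinuous (fun t => k * f t).
    exact: ccontinuousM.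
  have c1' := ccontinuousD cBJ (cst (-1)).
  have c2 := ccontinuousD cA c1'.
  have c3 := ccontinuousD (cZ (-2) _ cB) (cst 1).
  have c4 := ccontinuousD (cZ (-2) _ cA) c3.
  have c5 := ccontinuousD (cZ (2 * (1 - c)^-1) _ c2) c4.
  rewrite /F (cintegralD (cZ 2 _ cAB) c5).
  rewrite (cintegralD (cZ (2 * (1 - c)^-1) _ c2) c4).
  rewrite (cintegralD (cZ (-2) _ cA) c3) (cintegralD (cZ (-2) _ cB) (cst 1)).
  rewrite !cintegralZ// (cintegralD cA c1') (cintegralD cBJ (cst (-1))).
  rewrite cintegralJ// IA IB IAB cintegral1.
  have -> : cintegral (fun=> -1 : R[i]) = - (2 * pi)%:C%C.
    rewrite -cintegral1 -[RHS]mulN1r -cintegralZ; last exact: cst.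
    by apply: eq_cintegral => t; rewrite mulr1.
  rewrite conjc_real; move: (_%:C)%C => z; ring.
transitivity (complex.Re (cintegral F)).
  by apply: eq_Rintegral => t _; exact: PF.
rewrite IF.
by case: ((1 - c)^-1) => a b /=; ring.
Qed.

End cauchy.

(** * Joint law and arcs *)

Section joint_law.
Context d (T : measurableType d) (R : realType) (P : probability T R).
Variables (X1 X2 : T -> R).
Hypotheses (mX1 : measurable_fun setT X1) (mX2 : measurable_fun setT X2).
Hypothesis indep : forall A B : set R, measurable A -> measurable B ->
  P (X1 @^-1` A `&` X2 @^-1` B) = (P (X1 @^-1` A) * P (X2 @^-1` B))%E.
Variables p1 : R -> R.
Local Notation mu := (@lebesgue_measure R).
Variable I : set R.
Hypotheses (mI : measurable I) (mp1 : measurable_fun setT p1)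
  (p1_ge0 : forall x, 0 <= p1 x).
Hypothesis law1 : forall A : set R, measurable A ->
  P (X1 @^-1` A) = (\int[mu]_(t in A `&` I) (p1 t)%:E)%E.

Let X1' : T -> measurableTypeR R := X1.
Let mX1' : measurable_fun setT X1' := mX1.

Let mX12 : measurable_fun setT (fun w => (X1' w, X2 w)).
Proof. exact: measurable_fun_pair. Qed.

Let Y1 := HB.pack_for {mfun T >-> measurableTypeR R} X1'
  (isMeasurableFun.Build _ _ _ _ _ mX1').
Let Y2 := HB.pack_for {mfun T >-> R} X2 (isMeasurableFun.Build _ _ _ _ _ mX2).
Let Y12 := HB.pack_for {mfun T >-> (measurableTypeR R * R)%type}
  (fun w => (X1' w, X2 w))
  (isMeasurableFun.Build _ _ _ _ _ mX12).

Lemma measurable_section_prob (E : set (R * R)) : measurable E ->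
  measurable_fun setT (fun s => P (X2 @^-1` xsection E s)).
Proof. exact: (measurable_fun_xsection (distribution P Y2)). Qed.

(** Independence identifies the joint law with the product of the marginals, by uniqueness on
    rectangles. The product measure integrates sections against the law of [X1], which is then
    replaced by its density. *)
Lemma joint_probE (A : set R) (E : set (R * R)) : measurable A -> measurable E ->
  P (X1 @^-1` A `&` [set w | E (X1 w, X2 w)]) =
  (\int[mu]_(s in A `&` I) (P (X2 @^-1` xsection E s) * (p1 s)%:E))%E.
Proof.
move=> mA mE.
have mAE : measurable ((A `*` setT) `&` E).
  by apply: measurableI => //; exact: measurableX.
have prodE := @product_measure_unique _ _ _ _ _ (distribution P Y1)
  (distribution P Y2) (distribution P Y12) indep _ mAE.
transitivity (distribution P Y12 ((A `*` setT) `&` E)).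
  by congr (P _); apply/seteqP; split => w /= => [[]|[[]]].
rewrite -prodE /product_measure1 /=.
(* Extending [p1] by 0 outside [I] turns [law1] into a density over the whole line. *)
have law1' (B : set R) : measurable B ->
    distribution P Y1 B = (\int[mu]_(x in B) ((p1 \_ I) x)%:E)%E.
  move=> mB; rewrite [LHS]law1// integral_mkcondr.
  by apply: eq_integral => x _; rewrite restrict_EFin.
rewrite (ge0_integral_density (mu := mu) _ _ law1')//; last 3 first.
- exact/(measurable_restrictT p1 mI)/measurable_funTS.
- by move=> x; rewrite patchE; case: ifP.
- exact: measurable_fun_xsection.
rewrite [RHS]integral_mkcond; apply: eq_integral => x _; rewrite !patchE in_setI.
have [xI|xI] := boolP (x \in I); last by rewrite andbF mule0.
rewrite andbT; have [xA|xA] := boolP (x \in A).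
  congr (P _ * _)%E; apply/seteqP; split => w; rewrite /= /xsection /= !inE.
    by move=> [].
  by move=> ?; split => //; split => //; exact: set_mem.
(* For [x] outside [A] the section of [A * setT] is empty, so the integrand vanishes there. *)
rewrite (_ : xsection _ x = set0) ?measure0 ?mul0e//.
apply/seteqP; split => // y; rewrite /xsection/= inE => -[[/= Ax _] _].
by move/negP : xA; apply; rewrite inE.
Qed.

End joint_law.

Section proximity.
Context {R : realType}.
Implicit Types (phi : R[i]) (s t e : R).
Local Notation mu := (@lebesgue_measure R).
Local Notation I := (`[0, (2 * pi : R)[%classic).

Definition close_pairs e : set (R * R) :=
  [set p | normc (circ p.1 - circ p.2) < e].

(** The arc is centred at angle 0, where the chord condition becomes a condition on [cos t]. In the
    window [I] it wraps around, with one piece at each end. *)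
Definition arc_length e : R := fine (mu ([set t | 1 - e ^+ 2 / 2 < cos t] `&` I)).

Lemma measurable_cos_gt (x : R) : measurable [set t : R | x < cos t].
Proof.
rewrite -[X in measurable X]setTI; apply: measurable_fun_ltr => //.
by apply: continuous_measurable_fun; exact: continuous_cos.
Qed.

Lemma measurable_close_pairs e : 0 < e -> measurable (close_pairs e).
Proof.
move=> e0; have -> : close_pairs e =
    [set p : R * R | 1 - e ^+ 2 / 2 < cos (p.1 - p.2)].
  by apply/seteqP; split => p; rewrite /close_pairs /= normc_circB_lt.
rewrite -[X in measurable X]setTI; apply: measurable_fun_ltr => //.
apply: (@measurableT_comp _ _ _ _ _ _ (@cos R)).
  by apply: continuous_measurable_fun; exact: continuous_cos.
by apply: measurable_funB.
Qed.

(** The section at [s] is the arc at 0 translated by [s], and the cosine condition is periodic, so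
    [lebesgue_measure_period] applies. *)
Lemma measure_close_section s e : 0 < e -> I s ->
  mu (xsection (close_pairs e) s `&` I) = (arc_length e)%:E.
Proof.
move=> e0 Is; rewrite /arc_length fineK; last first.
  rewrite ge0_fin_numE// (@le_lt_trans _ _ (mu I))//; last first.
    by rewrite measure_period_itv ltry.
  rewrite le_measure// inE//; apply: measurableI => //.
  exact: measurable_cos_gt.
rewrite -[RHS](@lebesgue_measure_period R (2 * pi) s).
- congr (mu (_ `&` _)); apply/seteqP; split => t;
    by rewrite /xsection /= inE /close_pairs /= normc_circB_lt//
      -(cosN (s - t)) opprB.
- exact: measurable_cos_gt.
- by move=> x; rewrite /= (mulrC 2 pi) mulr_natr cosD2pi.
- by move: Is; rewrite /= in_itv/= => /andP[-> /ltW].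
Qed.

Lemma arc_length_gt0 e : 0 < e -> 0 < arc_length e.
Proof.
move=> e0; have pi20 : 0 < 2 * pi :> R by rewrite mulr_gt0 ?pi_gt0.
have : \forall t \near (0 : R), 1 - e ^+ 2 / 2 < cos t.
  apply: (cvgr_gt _ (@continuous_cos R 0)); rewrite cos0.
  by rewrite ltrBlDr ltrDl divr_gt0// exprn_gt0.
move=> /nbhs_ballP[r /= r0 ball_r].
(* [r] comes from continuity of the cosine at 0; the cap at [2 * pi] keeps the interval inside the
   window. *)
pose m := Num.min r (2 * pi).
have m0 : 0 < m by rewrite lt_min r0.
rewrite -lte_fin -(@measure_close_section 0)//; last by rewrite /= in_itv/= lexx.
apply: (@lt_le_trans _ _ (mu `[0, m[%classic)).
  by rewrite lebesgue_measure_itv/= lte_fin m0 -EFinB lte_fin subr0.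
apply: le_measure; rewrite ?inE//.
  apply: measurableI => //; apply: measurable_xsection.
  exact: measurable_close_pairs.
move=> t /=; rewrite !in_itv/= lt_min => /andP[t0 /andP[tr ->]]; split; last first.
  by rewrite t0.
rewrite /xsection /= inE /close_pairs /= normc_circB_lt// sub0r cosN.
by apply: ball_r; rewrite /ball/= sub0r normrN ger0_norm.
Qed.

Lemma continuous_exit_density phi : normc phi < 1 -> continuous (exit_density phi).
Proof.
move=> phi1; have n1 : normc (conjc phi) < 1 by rewrite normcJ.
have [cR _] := ccontinuous_cauchy n1.
have -> : exit_density phi = fun t =>
    (2 * pi)^-1 * (2 * complex.Re (cauchy_kernel (conjc phi) t) - 1).
  by apply/funext => t; rewrite -poissonE.
move=> t; apply: cvgMr; apply: cvgB; last exact: cvg_cst.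
by apply: cvgMr; exact: cR.
Qed.

End proximity.

(** * Asymptotics of the conditioning event *)

Section asymptotics.
Context (R : realType) (d : measure_display) (Omega : measurableType d)
  (P : probability Omega R) (phi1 phi2 : R[i]).
Hypotheses (hphi1 : normc phi1 < 1) (hphi2 : normc phi2 < 1).
Variables Theta1 Theta2 : Omega -> R.
Hypotheses (mTheta1 : measurable_fun setT Theta1)
  (mTheta2 : measurable_fun setT Theta2).
Local Notation mu := (@lebesgue_measure R).
Local Notation I := (`[0, (2 * pi : R)[%classic).
Hypotheses (indep : forall A B : set R, measurable A -> measurable B ->
     P (Theta1 @^-1` A `&` Theta2 @^-1` B)
     = (P (Theta1 @^-1` A) * P (Theta2 @^-1` B))%E)
  (law1 : forall A : set R, measurable A ->
     P (Theta1 @^-1` A) = (\int[mu]_(t in A `&` I) (exit_density phi1 t)%:E)%E)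
  (law2 : forall A : set R, measurable A ->
     P (Theta2 @^-1` A) = (\int[mu]_(t in A `&` I) (exit_density phi2 t)%:E)%E).

Let close_prob (A : set R) (e : R) : R :=
  fine (P (Theta1 @^-1` A `&`
           [set w | normc (circ (Theta1 w) - circ (Theta2 w)) < e])).

Let exit_density_integral_le1 (A : set R) : measurable A ->
  \int[mu]_(t in A `&` I) exit_density phi1 t <= 1.
Proof.
move=> mA; rewrite /Rintegral -law1// -lee_fin fineK ?fin_num_measure//.
  by apply: probability_le1; rewrite -[X in measurable X]setTI; exact: mTheta1.
by rewrite -[X in measurable X]setTI; exact: mTheta1.
Qed.

(** On the arc around [s] the second density differs from its value at [s] by at most [L * e]. The
    error keeps the factor [arc_length e], so it stays small after division by it. *)
Lemma section_prob_approx (L e : R) (s : R) : 0 < e -> I s ->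
  (forall s t, `|exit_density phi2 t - exit_density phi2 s| <=
               L * normc (circ s - circ t)) -> 0 <= L ->
  `|fine (P (Theta2 @^-1` xsection (close_pairs e) s))
    - arc_length e * exit_density phi2 s| <= L * e * arc_length e.
Proof.
move=> e0 Is lip L0; set B := xsection (close_pairs e) s.
have mB : measurable B by apply: measurable_xsection; exact: measurable_close_pairs.
have Bh := measure_close_section e0 Is; rewrite -/B in Bh.
have cstE (k : R) : \int[mu]_(t in B `&` I) k = k * arc_length e.
  rewrite Rintegral_cst; last exact: measurableI.
  by congr (_ * _); exact: (congr1 fine Bh).
have Icst (k : R) : mu.-integrable (B `&` I) (EFin \o (fun=> k)).
  by apply: integrable_setI_period => // t; exact: cvg_cst.
have Ip : mu.-integrable (B `&` I) (EFin \o exit_density phi2).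
  by apply: integrable_setI_period => //; exact: continuous_exit_density.
have near_s t : (B `&` I) t ->
    `|exit_density phi2 t - exit_density phi2 s| <= L * e.
  move=> [+ _]; rewrite /B /xsection /= inE /close_pairs /= => ste.
  by rewrite (le_trans (lip _ _))// ler_wpM2l// ltW.
have -> : fine (P (Theta2 @^-1` B)) = \int[mu]_(t in B `&` I) exit_density phi2 t.
  by rewrite law2.
rewrite ler_distl; apply/andP; split.
  rewrite [arc_length e * _]mulrC -mulrBl -cstE.
  apply: le_Rintegral => //; first exact: measurableI.
  by move=> t /near_s; rewrite ler_norml; lra.
rewrite [arc_length e * _]mulrC -mulrDl -cstE.
apply: le_Rintegral => //; first exact: measurableI.
by move=> t /near_s; rewrite ler_norml; lra.
Qed.

(** The section estimate is integrated against the first density. The constant is a Lipschitz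
    constant of the second density alone, hence uniform in [A] and [e]. *)
Lemma close_prob_approx : exists2 L : R, 0 <= L &
  forall (A : set R) (e : R), measurable A -> 0 < e ->
  `|close_prob A e / arc_length e -
    \int[mu]_(t in A `&` I) (exit_density phi1 t * exit_density phi2 t)| <= L * e.
Proof.
have [L L0 lip] := exit_density_lip hphi2.
exists L => // A e mA e0; set J := \int[mu]_(t in _) _.
have h0 := arc_length_gt0 e0; set h := arc_length e in h0 *.
pose p1 := @exit_density R phi1; pose p2 := @exit_density R phi2.
have cp1 : continuous p1 by exact: continuous_exit_density.
have cp2 : continuous p2 by exact: continuous_exit_density.
have p1_ge0 t : 0 <= p1 t by exact/ltW/exit_density_gt0.
have mp1 : measurable_fun setT p1 by exact: continuous_measurable_fun.
have mAI : measurable (A `&` I) by exact: measurableI.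
have mE := measurable_close_pairs e0.
pose f s := fine (P (Theta2 @^-1` xsection (close_pairs e) s)).
have mX s : measurable (Theta2 @^-1` xsection (close_pairs e) s).
  rewrite -[X in measurable X]setTI; apply: mTheta2 => //.
  exact: measurable_xsection.
have fE s : P (Theta2 @^-1` xsection (close_pairs e) s) = (f s)%:E.
  by rewrite fineK// fin_num_measure.
have f_ge0 s : 0 <= f s by rewrite -lee_fin -fE measure_ge0.
have f_le1 s : f s <= 1 by rewrite -lee_fin -fE probability_le1.
have mf : measurable_fun setT f.
  have := measurable_section_prob P mTheta2 mE.
  under eq_fun do rewrite fE.
  by move/measurable_EFinP.
have NE : close_prob A e = \int[mu]_(s in A `&` I) (f s * p1 s).
  rewrite /close_prob /Rintegral; congr fine.
  rewrite [LHS](joint_probE mTheta1 mTheta2 indep _ mp1 p1_ge0 law1 mA mE)//.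
  by apply: eq_integral => s _; rewrite fE -EFinM.
have Ip1 : mu.-integrable (A `&` I) (EFin \o p1) by exact: integrable_setI_period.
have Ifp : mu.-integrable (A `&` I) (EFin \o (fun s => f s * p1 s)).
  move: Ip1; apply: le_integrable => //.
    apply/measurable_EFinP; apply: measurable_funTS.
    exact: measurable_funM.
  move=> s _ /=; rewrite lee_fin normrM [`|f s|]ger0_norm//.
  by rewrite ler_piMl.
have Ip12 : mu.-integrable (A `&` I) (EFin \o (fun s => p1 s * p2 s)).
  by apply: integrable_setI_period => // t; apply: cvgM; [exact: cp1|exact: cp2].
have IZ (k : R) : mu.-integrable (A `&` I) (EFin \o (fun s => k * p1 s)).
  by apply: integrable_setI_period => // t; apply: cvgMr; exact: cp1.
have IZ2 (k : R) : mu.-integrable (A `&` I) (EFin \o (fun s => k * (p1 s * p2 s))).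
  apply: integrable_setI_period => // t; apply: cvgMr.
  by apply: cvgM; [exact: cp1|exact: cp2].
have diff : close_prob A e - h * J =
    \int[mu]_(s in A `&` I) (f s * p1 s - h * (p1 s * p2 s)).
  by rewrite RintegralB// NE RintegralZl.
have bound s : I s -> `|f s * p1 s - h * (p1 s * p2 s)| <= L * e * h * p1 s.
  move=> Is; rewrite [h * _]mulrCA [f s * _]mulrC -mulrBr normrM ger0_norm//.
  rewrite mulrC ler_wpM2r//.
  exact: section_prob_approx.
(* The first density has mass at most 1 over [A], so integrating the pointwise bound costs
   nothing. *)
have mass : L * e * h * \int[mu]_(s in A `&` I) p1 s <= L * e * h.
  rewrite ler_piMr ?exit_density_integral_le1//.
  by rewrite !mulr_ge0// ltW.
have key : `|close_prob A e - h * J| <= L * e * h.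
  apply: le_trans mass; rewrite diff -RintegralZl//.
  have Id : mu.-integrable (A `&` I)
      (EFin \o (fun s => f s * p1 s - h * (p1 s * p2 s))).
    have := integrableB _ Ifp (IZ2 h); apply => //.
  apply: (le_trans (le_normr_Rintegral _ Id)) => //.
  apply: le_Rintegral => //; first exact: integrable_norm Id.
  by move=> s [_ Is]; exact: bound.
rewrite -(ler_pM2r h0) -[X in _ * X <= _](gtr0_norm h0) -normrM mulrBl.
by rewrite -mulrA mulVf ?gt_eqF// mulr1 [J * h]mulrC.
Qed.

Lemma close_prob_cvg (A : set R) : measurable A ->
  close_prob A e / arc_length e @[e --> (0 : R)^'+] -->
  \int[mu]_(t in A `&` I) (exit_density phi1 t * exit_density phi2 t).
Proof.
move=> mA; have [L L0 approx] := close_prob_approx.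
apply/cvgrPdist_le => eps eps0.
have L1 : 0 < L + 1 by rewrite ltr_wpDl.
(* Dividing by [L + 1] rather than [L] covers the case [L = 0]. *)
have q0 : 0 < eps / (L + 1) by exact: divr_gt0.
near=> e.
rewrite distrC (le_trans (approx _ _ mA _))//.
have le_e : e <= eps / (L + 1) by near: e; exact: nbhs_right_le.
have e0 : 0 < e by [].
move: le_e; rewrite ler_pdivlMr// => ?; nra.
Unshelve. all: by end_near.
Qed.

End asymptotics.

(** * Normalising constant and conditional law *)

Lemma integral_exit_densityM (R : realType) (phi1 phi2 : R[i]) :
  normc phi1 < 1 -> normc phi2 < 1 ->
  \int[lebesgue_measure]_(t in `[0, (2 * pi : R)[)
    (exit_density phi1 t * exit_density phi2 t) =
  (2 * pi)^-1 * ((1 - normc (phi1 * conjc phi2) ^+ 2) /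
                 normc (1 - phi1 * conjc phi2) ^+ 2).
Proof.
move=> h1 h2.
have pi0 : 2 * pi != 0 :> R by rewrite mulf_neq0 ?gt_eqF ?pi_gt0.
transitivity (\int[lebesgue_measure]_(t in `[0, (2 * pi : R)[)
    ((2 * pi)^-1 ^+ 2 * (poisson phi1 t * poisson phi2 t))).
  apply: eq_Rintegral => t _; rewrite /exit_density -/(poisson _ _).
  by rewrite -/(poisson phi2 t) expr2 mulrACA.
rewrite RintegralZl//.
  by rewrite integral_poissonM// mulrA expr2 divfK.
have cP phi : normc phi < 1 -> continuous (@poisson R phi).
  move=> h; have -> : poisson phi = fun t => 2 * pi * exit_density phi t.
    by apply/funext => t; rewrite /exit_density mulrA divff// mul1r.
  by move=> t; apply: cvgMr; exact: continuous_exit_density.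
apply: continuous_integrable_period => t.
by apply: cvgM; exact: cP.
Qed.

(** The event that the exit points coincide has probability 0, so conditioning on it is read as the
    limit, as [e] decreases to 0, of conditioning on a chord shorter than [e]. Exit points are given
    by their angles: [law1] and [law2] place these almost surely in [[0, 2 * pi[], where arc length
    is Lebesgue measure. *)
Theorem theorem6 (R : realType) (d : measure_display) (Omega : measurableType d)
  (P : probability Omega R) (phi1 phi2 : R[i])
  (hphi1 : normc phi1 < 1) (hphi2 : normc phi2 < 1)
  (Theta1 Theta2 : Omega -> R)
  (mTheta1 : measurable_fun setT Theta1) (mTheta2 : measurable_fun setT Theta2)
  (indep : forall A B : set R, measurable A -> measurable B ->
     P (Theta1 @^-1` A `&` Theta2 @^-1` B)
     = (P (Theta1 @^-1` A) * P (Theta2 @^-1` B))%E)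
  (law1 : forall A : set R, measurable A ->
     P (Theta1 @^-1` A)
     = (\int[lebesgue_measure]_(t in A `&` `[0%R, (2 * pi)%R[) (exit_density phi1 t)%:E)%E)
  (law2 : forall A : set R, measurable A ->
     P (Theta2 @^-1` A)
     = (\int[lebesgue_measure]_(t in A `&` `[0%R, (2 * pi)%R[) (exit_density phi2 t)%:E)%E) :
  forall A : set R, measurable A ->
    (fine (P (Theta1 @^-1` A `&`
               [set w | normc (circ (Theta1 w) - circ (Theta2 w)) < e]))
     / fine (P [set w | normc (circ (Theta1 w) - circ (Theta2 w)) < e]))
    @[e --> (0 : R)^'+] -->
    fine (\int[lebesgue_measure]_(t in A `&` `[0%R, (2 * pi)%R[)
            (cond_density phi1 phi2 t)%:E)%E.
Proof.
move=> A mA.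
have h12 : normc (phi1 * conjc phi2) < 1.
  by rewrite ComplexField.Normc.normcM normcJ mulr_ilt1 ?normc_ge0.
(* [k] is the integral of the product of the two exit densities over the circle, and [cond_density]
   is that product divided by [k]. *)
pose k := (2 * pi)^-1 * ((1 - normc (phi1 * conjc phi2) ^+ 2) /
                         normc (1 - phi1 * conjc phi2) ^+ 2).
have d0 : 0 < normc (1 - phi1 * conjc phi2).
  rewrite (lt_le_trans _ (le_trans (ler_norm _) (ler_dist_normc _ _)))//.
  by rewrite ComplexField.Normc.normc1 subr_gt0.
have k0 : k != 0.
  rewrite gt_eqF// /k !(mulr_gt0, invr_gt0, exprn_gt0, pi_gt0)//.
  exact: normc_sqr_lt1.
have cvgA := close_prob_cvg hphi1 hphi2 mTheta1 mTheta2 indep law1 law2 mA.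
(* The denominator is the case where [A] is the whole line. *)
have := close_prob_cvg hphi1 hphi2 mTheta1 mTheta2 indep law1 law2
  (@measurableT _ (R : measurableType _)).
rewrite setTI integral_exit_densityM// -/k => cvgT.
have -> : fine (\int[lebesgue_measure]_(t in A `&` `[0%R, (2 * pi)%R[)
      (cond_density phi1 phi2 t)%:E)%E =
    \int[lebesgue_measure]_(t in A `&` `[0%R, (2 * pi)%R[)
      (exit_density phi1 t * exit_density phi2 t) / k.
  have m0 : 1 - normc (phi1 * conjc phi2) ^+ 2 != 0.
    by rewrite gt_eqF// normc_sqr_lt1.
  rewrite -RintegralZr//; [|exact: measurableI|].
    rewrite /Rintegral; congr fine; apply: eq_integral => t _; congr EFin.
    rewrite /cond_density /exit_density /k.
    move: (_ / normc (circ t - phi1) ^+ 2) (_ / normc (circ t - phi2) ^+ 2) => u v.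
    have : (2 * pi)^-1 != 0 :> R by rewrite gt_eqF// invr_gt0 mulr_gt0 ?pi_gt0.
    move: (2 * pi)^-1 => w w0; field.
    by rewrite w0 m0 (gt_eqF d0).
  apply: integrable_setI_period => // t.
  by apply: cvgM; exact: continuous_exit_density.
(* The quotient of the two limits, legitimate as [k] is nonzero. For [e > 0] the arc length is
   nonzero and cancels, so the quotients agree near 0 on the right. *)
apply: cvg_trans (cvgM cvgA (cvgV k0 cvgT)); apply: near_eq_cvg; near=> e.
have h0 : arc_length e != 0 by rewrite gt_eqF// arc_length_gt0.
by rewrite /= preimage_setT setTI invf_div mulrA divfK.
Unshelve. all: by end_near.
Qed.
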